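(* Let $p,p'$ be relatively prime positive integers with $p\ge3$ and $t=p'/p>2$. Then for all $1\le r\le p-1$ and $L\ge0$, $$\chi^{(p,p')}_{r,1;L}(q)=\sum_{m\ge0}\frac{q^{\frac{L^2}{4}+\frac L2}}{(q)_m}\,\chi^{(p,p'-p)}_{r,1;L-2m}(q).$$
   Context: Notation: $(q)_n=\prod_{j=1}^n(1-q^j)$ for $n\ge0$, $1/(q)_n=0$ for $n<0$, and $\begin{bmatrix} m\\ n\end{bmatrix}=\frac{(q)_m}{(q)_n(q)_{m-n}}$ (zero if $n<0$ or $n>m$). For coprime positive integers $p\ge 3$, $p'$ with $t=p'/p>1$ put $k=[t]$ (integer part), $\Delta^{(t)}_{r,1}=\frac{(rt-1)^2-(t-1)^2}{4t}$, $$K^{(p,\bar p')}_{m,r}(q)=q^{\frac{m^2-(r-1)^2}{4}}\sum_{n\in\mathbb Z}q^{p\bar p'n^2+\bar p'nr}\left(\begin{bmatrix} m\\ \frac{m-r+1}{2}-pn\end{bmatrix}-\begin{bmatrix} m\\ \frac{m+r+1}{2}+pn\end{bmatrix}\right),$$ $$Q^{(k)}(m_0,\dots,m_{k-1})=\frac{k-1}{4}m_0^2+\sum_{j=1}^{k-1}(k-j)m_j^2+\sum_{j=1}^{k-1}(k-j)m_0m_j+2\sum_{1\le j<j'\le k-1}(k-j')m_jm_{j'}+\frac{k-1}{2}m_0+\sum_{j=1}^{k-1}(k-j)m_j.$$ For $L\in\mathbb Z$ define $$\chi^{(p,p')}_{r,1;L}(q)=q^{\Delta^{(t)}_{r,1}}\sum\frac{q^{Q^{(k)}(m_0,\dots,m_{k-1})-\frac{k-1}{4}(r^2-1)}}{(q)_{m_0}\cdots(q)_{m_{k-1}}}K^{(p,p'-kp)}_{m_0,r}(q),$$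 the sum being over $m_0,\dots,m_{k-1}\in\mathbb Z_{\ge0}$ with $m_0\equiv r-1\bmod 2$ and $m_0+2(m_1+\cdots+m_{k-1})=L$ (so it is $0$ for $L<0$). The function $\chi^{(p,p'-p)}_{r,1;L}$ is defined by the same formulas with $p'$ replaced by $p'-p$ (hence $t$ by $t-1$ and $k$ by $k-1$). *)

(* Defs.v *)
From HB Require Import structures.
From mathcomp Require Import all_boot all_order all_algebra archimedean.
From mathcomp Require Import boolp classical_sets functions cardinality fsbigop.
From mathcomp Require Import reals exp.
Set Implicit Arguments.
Unset Strict Implicit.
Unset Printing Implicit Defensive.
Import Order.TTheory GRing.Theory Num.Theory.
Local Open Scope ring_scope.

(* A consistent choice of rational powers [e a = q^a] in a field F, where
   q = e 1 is not a root of unity, so that every (q)_n is invertible.  This is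
   all that is needed to give a meaning to the q-series below: F can be a field
   of formal series in rational powers of an indeterminate q, the complex
   numbers with 0 < |q| < 1 and a choice of log q, or the reals with 0 < q < 1
   (see [powR_qpowers]). *)
Record qpowers (F : fieldType) := QPowers {
  qpow :> rat -> F;
  qpow0 : qpow 0 = 1;
  qpowD : forall a b : rat, qpow (a + b) = qpow a * qpow b;
  qpow_neq1 : forall n : nat, (0 < n)%N -> qpow n%:R != 1
}.

Lemma powR_qpowers (R : realType) (q : R) : 0 < q -> q < 1 ->
  exists e : qpowers R, forall a : rat, e a = powR q (ratr a).
Proof.
move=> q0 q1.
have h0 : powR q (ratr 0) = 1 by rewrite rmorph0 powRr0.
have hD (a b : rat) : powR q (ratr (a + b)) = powR q (ratr a) * powR q (ratr b).
  by rewrite rmorphD powRD // (gt_eqF q0) implybT.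
have h1 (n : nat) : (0 < n)%N -> powR q (ratr n%:R) != 1.
  move=> n0; rewrite ratr_nat powR_mulrn ?ltW// lt_eqF//.
  by rewrite exprn_ilt1 ?ltW// -lt0n.
by exists (QPowers h0 hD h1).
Qed.

(* (q)_n *)
Definition qpoch (F : fieldType) (e : qpowers F) (n : nat) : F :=
  \prod_(1 <= j < n.+1) (1 - e j%:R).

(* 1/(q)_n, which is 0 for n < 0 *)
Definition qpoch_inv (F : fieldType) (e : qpowers F) (n : int) : F :=
  if n is Posz n' then (qpoch e n')^-1 else 0.

Definition qbinom (F : fieldType) (e : qpowers F) (m : nat) (n : int) : F :=
  qpoch e m * qpoch_inv e n * qpoch_inv e (m%:Z - n).

Definition Delta (t : rat) (r : nat) : rat :=
  ((r%:R * t - 1) ^+ 2 - (t - 1) ^+ 2) / (4 * t).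

(* K is only used for m = r - 1 mod 2, where the integer divisions by 2 are
   exact.  Only finitely many n in Z contribute; [\sum_(n \in A)] is the sum of
   the nonzero terms. *)
Definition K (F : fieldType) (e : qpowers F) (p p' m r : nat) : F :=
  e ((m%:R ^+ 2 - (r%:R - 1) ^+ 2) / 4) *
  \sum_(n \in [set: int])
    e ((p * p')%:R * n%:~R ^+ 2 + p'%:R * n%:~R * r%:R) *
    (qbinom e m (((m%:Z - r%:Z + 1) %/ 2)%Z - p%:Z * n)
     - qbinom e m (((m%:Z + r%:Z + 1) %/ 2)%Z + p%:Z * n)).

Definition Q (k : nat) (m : k.-tuple nat) : rat :=
  let M (j : nat) : rat := (nth 0%N m j)%:R in
  (k%:R - 1) / 4 * M 0%N ^+ 2
  + \sum_(1 <= j < k) (k%:R - j%:R) * M j ^+ 2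
  + \sum_(1 <= j < k) (k%:R - j%:R) * (M 0%N * M j)
  + 2 * (\sum_(1 <= j < k) \sum_(j.+1 <= j' < k) (k%:R - j'%:R) * (M j * M j'))
  + (k%:R - 1) / 2 * M 0%N
  + \sum_(1 <= j < k) (k%:R - j%:R) * M j.

Definition chi_index (k r : nat) (L : int) : set (k.-tuple nat) :=
  [set m : k.-tuple nat |
    ((nth 0%N m 0)%:Z = r%:Z - 1 %[mod 2])%Z /\
    (nth 0%N m 0 + 2 * \sum_(1 <= j < k) nth 0%N m j)%N%:Z = L].

Definition chi (F : fieldType) (e : qpowers F) (p p' r : nat) (L : int) : F :=
  let t : rat := p'%:R / p%:R in
  let k := Num.truncn t in
  e (Delta t r) *
  \sum_(m \in @chi_index k r L)
    e (Q m - (k%:R - 1) / 4 * (r%:R ^+ 2 - 1))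
    / (\prod_(0 <= j < k) qpoch e (nth 0%N m j))
    * K e p (p' - k * p) (nth 0%N m 0) r.

(* Main.v *)
Require Import Defs.
From mathcomp Require Import all_boot all_order all_algebra.
From mathcomp Require Import classical_sets fsbigop.
From mathcomp Require Import functions cardinality archimedean.
From mathcomp Require Import zify ring lra.
Import Order.TTheory GRing.Theory Num.Theory.
Local Open Scope ring_scope.

(** Both sides are the same sum over (m_0, ..., m_(k-1)): the summation variable
    m on the right is the last coordinate m_(k-1) on the left.  Since p' - k p
    does not change under (p', k) -> (p' - p, k - 1), the factor K is common to
    both sides, and only the powers of q have to be compared.  Passing from
    Q^(k-1) to Q^(k) raises each weight k - 1 - j to k - j and adds the
    variable m_(k-1) with weight 1; hence the difference is the form with all
    weights equal to 1, whose quadratic part is a complete square: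
      Q^(k) - Q^(k-1) = (L/2)^2 + L/2,   L = m_0 + 2 (m_1 + ... + m_(k-1))
    ([Qform_recr]).  In the prefactor, Delta is ((r^2 - 1) t - 2 (r - 1)) / 4, so
    it grows by (r^2 - 1) / 4 from t - 1 to t, and this is cancelled by the
    shift of k in the normalisation (k - 1)/4 (r^2 - 1) ([Delta_shift]). *)

(** * Finitely supported iterated sums *)

(** The slices of a finite set of pairs may overlap and have no common shape;
    extending the summand by zero to the product of the two projections reduces
    the statement to a rectangular sum. *)
Lemma fsbig_slices {R : Type} {idx : R} {op : Monoid.com_law idx}
    {I J : choiceType} (A : I -> set J) (F : I -> J -> R) :
  finite_set [set p : I * J | A p.1 p.2] ->
  \big[op/idx]_(i \in [set: I]) \big[op/idx]_(j \in A i) F i j =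
  \big[op/idx]_(p \in [set p : I * J | A p.1 p.2]) F p.1 p.2.
Proof.
set P := ([set p : I * J | A p.1 p.2]%classic) => Pfin.
have fin1 : finite_set (fst @` P)%classic by exact: finite_image.
have fin2 : finite_set (snd @` P)%classic by exact: finite_image.
rewrite -(@fsbig_widen _ _ _ _ (fst @` P)%classic) //; last first.
  move=> i [_ iP] /=; apply: fsbig1 => j Aij; exfalso.
  by apply: iP; exists (i, j).
have sliceE i : \big[op/idx]_(j \in A i) F i j =
    \big[op/idx]_(j \in snd @` P) (if j \in A i then F i j else idx).
  rewrite -fsbig_mkcondr; apply: eq_fsbigl; apply/seteqP; split => j //=.
    by move=> Aij; split=> //; exists (i, j).
  by case.
under eq_fsbigr do rewrite sliceE.
rewrite pair_fsbig //.
have -> : \big[op/idx]_(p \in P) F p.1 p.2 =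
    \big[op/idx]_(p \in (fst @` P `*` snd @` P) `&` P) F p.1 p.2.
  apply: eq_fsbigl; apply/seteqP; split => [[i j] /= Pij|p []//].
  by split=> //; split; exists (i, j).
rewrite [RHS]fsbig_mkcondr; apply: eq_fsbigr => -[i j] _ /=.
by congr (if _ then _ else _); apply/idP/idP; rewrite !inE.
Qed.

(** * Appending a coordinate to a summation index *)

Definition rcons_pair {k} (p : nat * k.-tuple nat) : k.+1.-tuple nat :=
  [tuple of rcons p.2 p.1].

Arguments rcons_pair : simpl never.

Lemma rcons_pair_inj k : injective (@rcons_pair k).
Proof.
move=> [m s] [m' s'] /(congr1 val) /= /rcons_inj [/val_inj -> ->] //.
Qed.

Lemma rcons_pair_surj k (u : k.+1.-tuple nat) : exists p, rcons_pair p = u.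
Proof.
case: u => u; case/lastP: u => [//|s x] us.
have sk : size s == k by move: us; rewrite size_rcons eqSS.
by exists (x, Tuple sk); apply: val_inj.
Qed.

Lemma nth_rcons_pair k m (s : k.-tuple nat) j : (j < k)%N ->
  nth 0%N (rcons_pair (m, s)) j = nth 0%N s j.
Proof. by move=> jk; rewrite nth_rcons size_tuple jk. Qed.

Lemma nth_rcons_pair_last k m (s : k.-tuple nat) :
  nth 0%N (rcons_pair (m, s)) k = m.
Proof. by rewrite nth_rcons size_tuple ltnn eqxx. Qed.

Lemma sum_rcons_pair k m (s : k.-tuple nat) : (0 < k)%N ->
  (\sum_(1 <= j < k.+1) nth 0 (rcons_pair (m, s)) j =
   \sum_(1 <= j < k) nth 0 s j + m)%N.
Proof.
move=> k0; rewrite big_nat_recr //= nth_rcons_pair_last; congr addn.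
by apply: eq_big_nat => j /andP[_ jk]; rewrite nth_rcons_pair.
Qed.

Lemma chi_index_rcons k r (L : int) m (s : k.-tuple nat) : (0 < k)%N ->
  @chi_index k.+1 r L (rcons_pair (m, s)) <->
  @chi_index k r (L - (2 * m)%N%:Z) s.
Proof.
move=> k0; rewrite /chi_index /= sum_rcons_pair // nth_rcons_pair //.
set S := (\sum_(1 <= j < k) _)%N.
by split=> -[-> h]; split=> //; lia.
Qed.

(** Every coordinate is at most L: it occurs in the weight equation with
    coefficient 1 or 2. *)
Lemma finite_chi_index k r (L : nat) : finite_set (@chi_index k r L%:Z).
Proof.
pose f (u : k.-tuple 'I_L.+1) : k.-tuple nat := map_tuple val u.
apply: (@sub_finite_set _ _ (f @` setT)); last first.
  exact/finite_image/finite_finset.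
move=> s [_ [sL]].
have sle i : (i < k)%N -> (nth 0 s i < L.+1)%N.
  case: i => [_|i ik]; first by rewrite -sL ltnS leq_addr.
  rewrite -sL ltnS (bigD1_seq i.+1) ?iota_uniq ?mem_index_iota //=.
  by set x := nth _ _ i.+1; set y := (\sum_(_ <- _ | _) _)%N; lia.
exists [tuple inord (nth 0%N s i) | i < k] => //.
apply: eq_from_tnth => i; rewrite tnth_map tnth_mktuple /= inordK.
  by rewrite (tnth_nth 0%N).
exact: sle.
Qed.

(** * Comparing the powers of q *)

Lemma sqr_sum_nat (R : comNzRingType) (M : nat -> R) k :
  (\sum_(1 <= j < k) M j) ^+ 2 =
  \sum_(1 <= j < k) M j ^+ 2
  + 2 * (\sum_(1 <= j < k) \sum_(j.+1 <= j' < k) M j * M j').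
Proof.
elim: k => [|[|k] IH]; [by rewrite !big_geq ?expr0n ?mulr0 ?addr0.. |].
rewrite big_nat_recr // [in RHS]big_nat_recr // [X in 2 * X]big_nat_recr //=.
rewrite (@big_geq _ _ _ k.+2) // addr0.
have -> : \sum_(1 <= j < k.+1) \sum_(j.+1 <= j' < k.+2) M j * M j' =
    \sum_(1 <= j < k.+1) \sum_(j.+1 <= j' < k.+1) M j * M j' +
    (\sum_(1 <= j < k.+1) M j) * M k.+1.
  rewrite mulr_suml -big_split; apply: eq_big_nat => j /andP[_ jk].
  by rewrite big_nat_recr.
by rewrite sqrrD IH; ring.
Qed.

(** Raising all weights by one adds the sum of the unweighted terms, and the
    new term k enters with weight k + 1 - k = 1. *)
Lemma sum_weight_recr (M : nat -> rat) k n : (n <= k)%N ->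
  \sum_(n <= j < k.+1) (k.+1%:R - j%:R) * M j =
  \sum_(n <= j < k) (k%:R - j%:R) * M j + \sum_(n <= j < k) M j + M k.
Proof.
move=> nk; rewrite big_nat_recr //= -big_split /=; congr (_ + _).
  by apply: eq_bigr => j _; rewrite -natr1; ring.
by rewrite -natr1; ring.
Qed.

(** [Q] as a quadratic polynomial in an infinite family of variables, so that
    the number k of variables in use can change without a change of type. *)
Definition Qform (k : nat) (M : nat -> rat) : rat :=
  (k%:R - 1) / 4 * M 0%N ^+ 2
  + \sum_(1 <= j < k) (k%:R - j%:R) * M j ^+ 2
  + \sum_(1 <= j < k) (k%:R - j%:R) * (M 0%N * M j)
  + 2 * (\sum_(1 <= j < k) \sum_(j.+1 <= j' < k) (k%:R - j'%:R) * (M j * M j'))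
  + (k%:R - 1) / 2 * M 0%N
  + \sum_(1 <= j < k) (k%:R - j%:R) * M j.

Lemma eq_Qform k (M N : nat -> rat) : (0 < k)%N ->
  (forall j, (j < k)%N -> M j = N j) -> Qform k M = Qform k N.
Proof.
move=> k0 MN; rewrite /Qform MN //.
congr (_ + _ + _ + 2 * _ + _ + _);
  apply: eq_big_nat => j /andP[_ jk]; rewrite ?MN //.
by apply: eq_big_nat => i /andP[_ ik]; rewrite MN.
Qed.

(** The increment is the form with all weights one; with the linear terms it is
    (L/2)^2 + L/2, where half of M_0 is counted along with the other M_j. *)
Lemma Qform_recr k (M : nat -> rat) : (0 < k)%N ->
  let L := M 0%N + 2 * (\sum_(1 <= j < k) M j + M k) in
  Qform k.+1 M = Qform k M + (L ^+ 2 / 4 + L / 2).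
Proof.
move=> k0 L; rewrite /L /Qform !sum_weight_recr //.
have -> : \sum_(1 <= j < k.+1) \sum_(j.+1 <= j' < k.+1)
      (k.+1%:R - j'%:R) * (M j * M j') =
    \sum_(1 <= j < k) \sum_(j.+1 <= j' < k) (k%:R - j'%:R) * (M j * M j') +
    \sum_(1 <= j < k) \sum_(j.+1 <= j' < k) M j * M j' +
    (\sum_(1 <= j < k) M j) * M k.
  rewrite big_nat_recr //= [X in _ + X]big_geq // addr0.
  rewrite mulr_suml -!big_split; apply: eq_big_nat => j /andP[_ jk] /=.
  by rewrite (sum_weight_recr (fun i => M j * M i)).
rewrite -(mulr_sumr _ _ _ (M 0%N)) -natr1.
move: (@sqr_sum_nat _ M k); set S := \sum_(1 <= j < k) M j.
set D := \sum_(1 <= j < k) \sum_(j.+1 <= j' < k) M j * M j'.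
move=> /esym /(canRL (addrK _)) ->.
by field.
Qed.

Lemma Q_rcons k m (s : k.-tuple nat) : (0 < k)%N ->
  let L : rat := (nth 0 s 0 + 2 * (\sum_(1 <= j < k) nth 0 s j + m))%N%:R in
  Q (rcons_pair (m, s)) = Q s + (L ^+ 2 / 4 + L / 2).
Proof.
move=> k0 L.
pose M' j : rat := (nth 0%N (rcons_pair (m, s)) j)%:R.
pose M j : rat := (nth 0%N s j)%:R.
have MM j : (j < k)%N -> M' j = M j by move=> jk; rewrite /M' nth_rcons_pair.
rewrite -[Q (rcons_pair _)]/(Qform k.+1 M') -[Q s]/(Qform k M).
rewrite Qform_recr // (eq_Qform _ _ M) //; congr (_ + _).
suff -> : M' 0%N + 2 * (\sum_(1 <= j < k) M' j + M' k) = L by [].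
rewrite /L natrD natrM natrD natr_sum MM // /M' nth_rcons_pair_last.
congr (_ + _ * (_ + _)).
by apply: eq_big_nat => j /andP[_ jk]; rewrite nth_rcons_pair.
Qed.

(** The t-dependence of Delta is linear: r t - 1 and t - 1 have squares with
    the same constant term, which leaves ((r^2 - 1) t - 2 (r - 1)) / 4. *)
Lemma Delta_shift (t : rat) r : 1 < t ->
  Delta t r = Delta (t - 1) r + (r%:R ^+ 2 - 1) / 4.
Proof.
move=> t1; rewrite /Delta; field.
by apply/andP; split; lra.
Qed.

(** * The recurrence *)

Theorem proposition3p2 (F : fieldType) (e : qpowers F) (p p' : nat)
  (hp : (3 <= p)%N) (hp' : (0 < p')%N) (hcop : coprime p p')
  (ht : 2 < p'%:R / p%:R :> rat)
  (r : nat) (hr1 : (1 <= r)%N) (hr2 : (r <= p - 1)%N) (L : nat) :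
  chi e p p' r L%:Z =
  \sum_(m \in [set: nat])
    e (L%:R ^+ 2 / 4 + L%:R / 2) / qpoch e m
    * chi e p (p' - p) r (L%:Z - (2 * m)%N%:Z).
Proof.
have p_neq0 : p%:R != 0 :> rat by rewrite pnatr_eq0; lia.
have lt2p : (2 * p < p')%N.
  move: ht; rewrite ltr_pdivlMr ?ltr0n; last by lia.
  by rewrite -natrM ltr_nat.
have tE : (p' - p)%:R / p%:R = p'%:R / p%:R - 1 :> rat.
  by rewrite natrB; [field | lia].
rewrite /chi tE; set t : rat := (p'%:R / p%:R) in ht *.
have [k k0 [kE kE']] : exists2 k, (0 < k)%N &
    Num.truncn t = k.+1 /\ Num.truncn (t - 1) = k.
  exists (Num.truncn (t - 1)); first by rewrite truncn_gt0; lra.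
  have t1 : 0 <= t - 1 by lra.
  split=> //; apply: truncn_def; move: (truncn_itv t1) => /andP[].
  by rewrite -!natr1 => h1 h2; apply/andP; split; lra.
rewrite kE kE'.
have -> : (p' - p - k * p = p' - k.+1 * p)%N by rewrite mulSn subnDA.
under [RHS]eq_fsbigr do rewrite mulrA mulr_fsumr.
rewrite mulr_fsumr.
have preimE : [set u | @chi_index k r (L%:Z - (2 * u.1)%N%:Z) u.2]%classic
    = (@rcons_pair k @^-1` @chi_index k.+1 r L%:Z)%classic.
  apply/seteqP; split=> -[m s] /= h; exact/chi_index_rcons.
rewrite fsbig_slices; last first.
  rewrite preimE; apply: finite_preimage; last exact: finite_chi_index.
  by move=> x y _ _; apply: rcons_pair_inj.
rewrite (@reindex_fsbig _ _ _ _ _ (@rcons_pair k)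
    [set u | @chi_index k r (L%:Z - (2 * u.1)%N%:Z) u.2]%classic); last first.
  rewrite preimE; split => //; first by move=> x y _ _; apply: rcons_pair_inj.
  by move=> u hu; have [v vu] := rcons_pair_surj k u; exists v; rewrite //= vu.
apply: eq_fsbigr => -[m s]; rewrite inE /=.
move: (m : nat) (s : k.-tuple nat) => {}m {}s [_ hL].
have LE : L%:R = (nth 0 s 0 + 2 * (\sum_(1 <= j < k) nth 0 s j + m))%N%:R :> rat.
  by congr _%:R; move: hL; set S := (\sum_(1 <= j < k) _)%N; lia.
rewrite nth_rcons_pair // big_nat_recr //= nth_rcons_pair_last Q_rcons // -LE.
have -> : \prod_(0 <= j < k) qpoch e (nth 0%N (rcons_pair (m, s)) j) =
    \prod_(0 <= j < k) qpoch e (nth 0%N s j).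
  by apply: eq_big_nat => j /andP[_ jk]; rewrite nth_rcons_pair.
rewrite Delta_shift; last by lra.
set E := L%:R ^+ 2 / 4 + L%:R / 2.
set P := \prod_(_ <= _ < _) _; set c : rat := r%:R ^+ 2 - 1.
(* The shift c / 4 of Delta meets -c / 4 coming from the normalisation. *)
have qE : e (Delta (t - 1) r + c / 4) * e (Q s + E - (k.+1%:R - 1) / 4 * c) =
    e E * e (Delta (t - 1) r) * e (Q s - (k%:R - 1) / 4 * c).
  by rewrite -!qpowD -natr1; congr (e _); field.
rewrite invfM; move: qE; set a := e _; set b := e _.
move=> qE; rewrite !mulrA qE.
by rewrite -!mulrA; congr (_ * _); rewrite mulrC -!mulrA; ring.
Qed.
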